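(* For all $n\ge 1$, $\pi^{c}(P_n)=\lceil 2n/3\rceil$, and for all $n\ge 3$, $\pi^{c}(C_n)=\lceil 2n/3\rceil$.
   Context: $P_n$ and $C_n$ are the path and cycle on $n$ vertices. A configuration of cops on a graph $G$ is a function $C:V(G)\to\mathbb{Z}_{\ge 0}$ of size $\sum_v C(v)$. A pebbling step from a vertex $u$ with at least two cops to an adjacent vertex $v$ removes two cops from $u$ and adds one cop to $v$. In the cops and robbers pebbling game, cops are placed according to $C$, then a robber chooses a starting vertex; thereafter, in each turn the cops make pebbling steps, after which the robber either moves to an adjacent vertex or stays put. The robber is captured when he occupies a vertex holding at least one cop. The cop pebbling number $\pi^{c}(G)$ is the minimum $m$ such that some configuration of size $m$ allows the cops to capture the robber regardless of how he starts and moves. *)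

(* Defs.v *)
(* boolp is used only to reflect "the cops win" as a boolean. *)
From HB Require Import structures.
From mathcomp Require Import all_boot all_order all_algebra.
From mathcomp Require Import boolp.

Set Implicit Arguments.
Unset Strict Implicit.
Unset Printing Implicit Defensive.

Definition path_rel (n : nat) : rel 'I_n :=
  fun i j => (i.+1 == j :> nat) || (j.+1 == i :> nat).

(* This is the simple cycle C_n only for n >= 3. *)
Definition cycle_rel (n : nat) : rel 'I_n :=
  fun i j => (i.+1 %% n == j :> nat) || (j.+1 %% n == i :> nat).

Lemma path_rel_sym n : symmetric (@path_rel n).
Proof. by move=> i j; rewrite /path_rel orbC. Qed.

Lemma path_rel_irr n : irreflexive (@path_rel n).
Proof. by move=> i; rewrite /path_rel orbb gtn_eqF. Qed.

Lemma cycle_rel_sym n : symmetric (@cycle_rel n).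
Proof. by move=> i j; rewrite /cycle_rel orbC. Qed.

Lemma cycle_rel_irr n : 3 <= n -> irreflexive (@cycle_rel n).
Proof.
move=> n3 i; rewrite /cycle_rel orbb.
have := ltn_ord i; rewrite leq_eqVlt => /predU1P[in_|lt_in].
  by rewrite in_ modnn; apply/eqP => i0; rewrite -in_ -i0 in n3.
by rewrite modn_small // gtn_eqF.
Qed.

Section Game.

(* The graph is given by its adjacency relation e on the vertex type T. *)
Variables (T : finType) (e : rel T).

Definition config := {ffun T -> nat}.

Definition config_size (C : config) : nat := \sum_v C v.

Definition pebbling_step (C C' : config) : bool :=
  [exists u, exists v,
    [&& e u v, 2 <= C u &
        C' == [ffun w => C w - 2 * (w == u) + (w == v)]]].

(* The rules leave open whether the steps of one turn are made one after the
   other, a cop that has just arrived being allowed to step again, or at the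
   same time, as in the usual game of cops and robbers, where a cop crosses at
   most one edge per turn.  Both conventions are provided.  In both of them the
   number of steps of a turn is arbitrary, and may be zero. *)
Inductive turn_rule := Successive | Simultaneous.

Definition successive_turn (C C' : config) : Prop :=
  exists2 s : seq config, path pebbling_step C s & C' = last C s.

(* f u v is the number of steps made from u to v; all the cops taking part in
   these steps must be present at the beginning of the turn. *)
Definition simultaneous_turn (C C' : config) : Prop :=
  exists f : T -> T -> nat,
    [/\ forall u v, 0 < f u v -> e u v,
        forall u, 2 * (\sum_v f u v) <= C u
      & forall w, C' w = C w - 2 * (\sum_v f w v) + \sum_u f u w].

Definition cops_turn (rule : turn_rule) : config -> config -> Prop :=
  match rule with
  | Successive => successive_turn
  | Simultaneous => simultaneous_turn
  end.

Definition robber_move (r r' : T) : bool := (r' == r) || e r r'.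

Definition captured (C : config) (r : T) : bool := 0 < C r.

(* cops_force rule C r: in the position where the cops stand according to C, the
   robber stands on r and the cops are to play, the cops can force the capture
   after finitely many turns.  A cop stepping onto r in the middle of a
   successive turn is accounted for by ending the turn there. *)
Inductive cops_force (rule : turn_rule) : config -> T -> Prop :=
| Force_now C r : captured C r -> cops_force rule C r
| Force_capture C C' r :
    cops_turn rule C C' -> captured C' r -> cops_force rule C r
| Force_continue C C' r :
    cops_turn rule C C' ->
    (forall r', robber_move r r' -> cops_force rule C' r') ->
    cops_force rule C r.

Definition cops_win (rule : turn_rule) (C : config) : Prop :=
  forall r, cops_force rule C r.

Definition cops_win_with (rule : turn_rule) (m : nat) : Prop :=
  exists2 C : config, config_size C = m & cops_win rule C.

Lemma cops_win_with_some rule : exists m, `[< cops_win_with rule m >].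
Proof.
exists (config_size [ffun=> 1]); apply/asboolP; exists [ffun=> 1] => // r.
by apply: Force_now; rewrite /captured ffunE.
Qed.

Definition cop_pebbling_number (rule : turn_rule) : nat :=
  ex_minn (cops_win_with_some rule).

End Game.

(* Main.v *)
(* A robber who never moves is caught only on a vertex that pebbling steps can
   reach.  On a cycle, let S r be the sum of the cops weighted by 2^-d, d being
   the clockwise distance to r, and S' r its counterclockwise analogue: if both
   are less than 1 then no step raises either of them, so r is never reached.
   Since S (r+1) <= C (r+1) + S r / 2, a potential argument around the cycle
   shows that 2 #{C > 0} + 4 #{C = 0, S >= 1} <= 3 m for m cops, and the same
   for S'; adding the two, if all vertices are reachable then 4 n <= 6 m.
   Conversely, two cops on the middle of every three consecutive vertices leave
   every vertex occupied or next to two cops. *)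
Require Import Defs.
From mathcomp Require Import all_boot all_order all_algebra.
From mathcomp Require Import zify lra boolp.
Import GRing.Theory Num.Theory.

Set Implicit Arguments.
Unset Strict Implicit.
Unset Printing Implicit Defensive.

(** * Weights under the cops' turns *)

Section Turns.

Variables (T : finType) (e : rel T).
Implicit Types (C : config T) (w : T -> nat).

Definition weight w C := \sum_v C v * w v.

Lemma pebbling_step_simultaneous C C' :
  pebbling_step e C C' -> simultaneous_turn e C C'.
Proof.
case/existsP=> u /existsP[v /and3P[euv Cu /eqP->]].
have out x : \sum_y ((x == u) && (y == v)) = (x == u) :> nat.
  case: eqP => _; last by rewrite big1.
  by rewrite (bigD1 v) //= eqxx big1 // => y /negPf->.
exists (fun x y => (x == u) && (y == v)); split=> [x y|x|x].
- by case: eqP => [->|//]; case: eqP => [->|].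
- by rewrite out; case: eqP => [->|].
- rewrite ffunE out; congr (_ + _); rewrite (bigD1 u) //= eqxx big1 ?addn0 //.
  by move=> y /negPf->.
Qed.

Lemma pebbling_step_turn rule C C' :
  pebbling_step e C C' -> cops_turn e rule C C'.
Proof.
case: rule => [st|]; last exact: pebbling_step_simultaneous.
by exists [:: C'] => //=; rewrite st.
Qed.

(** A single pebbling step is itself a simultaneous turn, so invariants need only be checked for
    simultaneous turns, whichever rule is in force. *)
Lemma cops_turn_ind (P : config T -> Prop) rule C C' :
    (forall C1 C2, simultaneous_turn e C1 C2 -> P C1 -> P C2) ->
  cops_turn e rule C C' -> P C -> P C'.
Proof.
move=> PS; case: rule => [[s]|/=]; last exact: PS.
elim: s C => [|C1 s IHs] C /=; first by move=> _ ->.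
case/andP=> /pebbling_step_simultaneous st ps lastE PC.
exact: IHs ps lastE (PS _ _ st PC).
Qed.

(** A step from [u] to [v] trades [2 * w u] for [w v], a gain only if [v] is [r]; and no step enters
    [r], since no neighbour of [r] has two cops. *)
Lemma simultaneous_turn_weight w r C C' :
    simultaneous_turn e C C' ->
    (forall u v, e u v -> v != r -> w v <= 2 * w u) ->
    (forall u, e u r -> C u < 2) ->
  weight w C' <= weight w C.
Proof.
case=> f [fe fC C'E] w2 Cr.
have -> : weight w C' = \sum_v (C v - 2 * \sum_x f v x) * w v
                      + \sum_u \sum_v f u v * w v.
  rewrite exchange_big -big_split; apply: eq_bigr => v _ /=.
  by rewrite C'E mulnDl big_distrl.
have -> : weight w C = \sum_v (C v - 2 * \sum_x f v x) * w v
                     + \sum_u \sum_v f u v * (2 * w u).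
  rewrite -big_split; apply: eq_bigr => v _ /=.
  by rewrite -big_distrl /= mulnCA mulnA -mulnDl subnK.
rewrite leq_add2l; apply: leq_sum => u _; apply: leq_sum => v _.
have [->//|fuv] := posnP (f u v); rewrite leq_pmul2l //.
apply: w2; first exact: fe.
apply/eqP=> vr; have := Cr u; rewrite -vr fe // => /(_ isT).
have := fC u; rewrite (bigD1 v) //=; lia.
Qed.

Lemma weight_ge w C u : C u * w u <= weight w C.
Proof. by rewrite /weight (bigD1 u) //= leq_addr. Qed.

(** Against a robber who stays on [r], having both weights below [N] is an invariant. The two must
    be kept together: each neighbour of [r] may be controlled by only one of them. *)
Lemma cops_force_weight w w' N r rule C :
    w r = N ->
    (forall u v, e u v -> v != r -> w v <= 2 * w u) ->
    (forall u v, e u v -> v != r -> w' v <= 2 * w' u) ->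
    (forall u, e u r -> N <= 2 * w u \/ N <= 2 * w' u) ->
  cops_force e rule C r -> N <= weight w C \/ N <= weight w' C.
Proof.
move=> wr w2 w2' wN.
pose safe C0 := weight w C0 < N /\ weight w' C0 < N.
have turn C1 C2 : cops_turn e rule C1 C2 -> safe C1 -> safe C2.
  apply: cops_turn_ind => {}C1 {}C2 st [S1 S1'].
  (* Two cops on a neighbour [u] would bring one of the weights up to [N]. *)
  have Cr u : e u r -> C1 u < 2.
    move=> /wN; have := weight_ge w C1 u; have := weight_ge w' C1 u; nia.
  split; last exact: leq_ltn_trans (simultaneous_turn_weight st w2' Cr) S1'.
  exact: leq_ltn_trans (simultaneous_turn_weight st w2 Cr) S1.
have free C0 : captured C0 r -> ~ safe C0.
  by rewrite /captured => C0r [S0 _]; have := weight_ge w C0 r; nia.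
suff force r0 : cops_force e rule C r0 -> r0 = r -> ~ safe C.
  move=> /force/(_ erefl) nS.
  case: (leqP N (weight w C)) => [|h]; first by left.
  by case: (leqP N (weight w' C)) => [|h']; [right | case: nS].
elim=> {C r0} [C r0 + r0E|C C' r0 tn + r0E|C C' r0 tn _ IH r0E].
- by rewrite r0E; apply: free.
- by rewrite r0E => cap /(turn _ _ tn); apply: free.
(* The robber replies by staying put. *)
- by move=> /(turn _ _ tn); apply: (IH r0) => //; rewrite /robber_move eqxx.
Qed.

End Turns.

(** * The potential argument around the cycle *)

Section Counting.

(** Credit carried to the next vertex when [a] whole units of weight are available. It is tight for
    two cops on one vertex: [3 * 2] pays 2 for that vertex and leaves 4 for an empty vertex after
    it. *)
Definition potential a := if 2 <= a then 3 * a - 2 else 0.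

Lemma potential_step a b c : b <= c + a %/ 2 ->
  potential b + 2 * (0 < c) + 4 * ((c == 0) && (0 < b)) <= 3 * c + potential a.
Proof. by rewrite /potential; case: ifP; case: ifP; case: c => [|c]; lia. Qed.

(** Sum [potential_step] over all vertices, with the weight at [r] in whole units of [N]. As [s]
    permutes the vertices, the potentials on the two sides cancel. *)
Lemma reach_count (T : finType) (C : config T) (w : T -> T -> nat)
    (s : T -> T) N :
    injective s -> 0 < N -> (forall r, w r r = N) ->
    (forall r v, v != s r -> 2 * w (s r) v <= w r v) ->
  \sum_r (2 * (0 < C r) + 4 * ((C r == 0) && (N <= weight (w r) C)))
    <= 3 * config_size C.
Proof.
move=> s_inj N0 wN w2; pose a r := weight (w r) C %/ N.
have a_step r : a (s r) <= C (s r) + a r %/ 2.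
  have le : 2 * weight (w (s r)) C <= 2 * C (s r) * N + weight (w r) C.
    rewrite /weight big_distrr (bigD1 (s r)) //= wN mulnA leq_add2l.
    rewrite [leqRHS](bigD1 (s r)) //= (leq_trans _ (leq_addl _ _)) //.
    by apply: leq_sum => v /(w2 r); nia.
  (* Rounding down by [N] and by 2 commute, so [le] passes to integer parts. *)
  rewrite /a -divnMA [N * 2]mulnC divnMA.
  have -> : C (s r) + weight (w r) C %/ 2 %/ N
          = (C (s r) * N + weight (w r) C %/ 2) %/ N by rewrite divnMDl.
  by apply: leq_div2r; lia.
pose g r := 2 * (0 < C r) + 4 * ((C r == 0) && (0 < a r)).
have : \sum_r (potential (a (s r)) + g (s r))
    <= \sum_r (3 * C (s r) + potential (a r)).
  by apply: leq_sum => r _; rewrite addnA potential_step.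
rewrite [leqLHS]big_split [leqRHS]big_split /=
  -(reindex_inj (P := xpredT) (F := fun r => potential (a r)) s_inj).
rewrite -(reindex_inj (P := xpredT) (F := g) s_inj).
rewrite -(reindex_inj (P := xpredT) (F := fun r => 3 * C r) s_inj).
rewrite -big_distrr /= addnC leq_add2r.
by rewrite /g; under eq_bigr do rewrite divn_gt0 //.
Qed.

End Counting.

(** * The lower bound, for subgraphs of the cycle *)

Section Cycle.

Variable n : nat.
Implicit Types i j r u v : 'I_n.

(* Clockwise, from i to j. *)
Definition arc_length i j := if i <= j then j - i else j + n - i.

(* 2 ^ -d scaled by 2 ^ n to stay in nat. *)
Definition arc_weight i j := 2 ^ (n - arc_length i j).

Lemma ordS_val i : ordS i = (if i.+1 == n then 0 else i.+1) :> nat.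
Proof.
have := ltn_ord i; rewrite /=; case: eqP => [->|ne lt]; first by rewrite modnn.
by rewrite modn_small //; lia.
Qed.

Lemma cycle_relE i j : cycle_rel i j = (j == ordS i) || (i == ordS j).
Proof. by rewrite /cycle_rel -!(inj_eq val_inj) /= ![_ %% _ == _]eq_sym. Qed.

Lemma arc_length_lt i j : arc_length i j < n.
Proof. by rewrite /arc_length; case: ifP; have := ltn_ord j; lia. Qed.

Lemma arc_weightxx i : arc_weight i i = 2 ^ n.
Proof. by rewrite /arc_weight /arc_length leqnn subnn subn0. Qed.

(** The hypothesis rules out the place where the length drops from [n - 1] to 0. *)
Lemma arc_length_ordSr i j : i != ordS j ->
  arc_length i (ordS j) = (arc_length i j).+1.
Proof.
rewrite -(inj_eq val_inj) /arc_length [val (ordS j)]ordS_val ordS_val /=.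
by have := ltn_ord i; have := ltn_ord j; case: (j.+1 =P n); do 2?case: ifP; lia.
Qed.

Lemma arc_length_ordSl i j : i != j ->
  (arc_length (ordS i) j).+1 = arc_length i j.
Proof.
rewrite -(inj_eq val_inj) /arc_length ordS_val /=.
have := ltn_ord i; have := ltn_ord j.
by case: (i.+1 =P n); rewrite ?leq0n; do 2?case: ifP; lia.
Qed.

Lemma arc_weight_ordSr i j : i != ordS j ->
  2 * arc_weight i (ordS j) = arc_weight i j.
Proof.
move=> ij; rewrite /arc_weight arc_length_ordSr // -expnS; congr (2 ^ _).
by have := arc_length_lt i (ordS j); rewrite arc_length_ordSr //; lia.
Qed.

Lemma arc_weight_ordSl i j : i != j ->
  2 * arc_weight i j = arc_weight (ordS i) j.
Proof.
move=> ij; rewrite /arc_weight -(arc_length_ordSl ij) -expnS; congr (2 ^ _).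
by have := arc_length_lt i j; rewrite -(arc_length_ordSl ij); lia.
Qed.

Lemma arc_weight_le i j : arc_weight i j <= 2 ^ n.
Proof. by rewrite leq_exp2l ?leq_subr. Qed.

Lemma cops_win_size (e : rel 'I_n) rule (C : config 'I_n) :
    subrel e (@cycle_rel n) -> cops_win e rule C ->
  2 * n <= 3 * config_size C.
Proof.
move=> e_cycle win.
have reach r : 2 ^ n <= weight (fun v => arc_weight v r) C
            \/ 2 ^ n <= weight (arc_weight r) C.
  apply: cops_force_weight (win r) => [|u v /e_cycle|u v /e_cycle|u /e_cycle];
    rewrite ?arc_weightxx // cycle_relE => /orP[] /eqP->.
  - move=> _; have [->|ur] := eqVneq u r.
      by rewrite arc_weightxx (leq_trans (arc_weight_le _ _)) ?leq_pmull.
    by rewrite arc_weight_ordSl.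
  - by move=> vr; rewrite -(arc_weight_ordSl vr); lia.
  - by rewrite eq_sym => vr; rewrite -(arc_weight_ordSr vr); lia.
  - move=> _; have [->|ru] := eqVneq r (ordS v).
      by rewrite arc_weightxx (leq_trans (arc_weight_le _ _)) ?leq_pmull.
    by rewrite arc_weight_ordSr.
  (* A vertex is its own successor only for [n = 1], where [cycle_rel] has a loop. *)
  - have [<-|ne] := eqVneq u (ordS u); first by left; rewrite arc_weightxx; lia.
    by left; rewrite arc_weight_ordSl // arc_weightxx.
  - have [<-|ne] := eqVneq r (ordS r); first by left; rewrite arc_weightxx; lia.
    by right; rewrite arc_weight_ordSr // arc_weightxx.
have N0 : 0 < 2 ^ n by rewrite expn_gt0.
have cw := reach_count C (w := fun r v => arc_weight v r) (@ordS_inj n) N0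
  arc_weightxx (fun r v vr => eq_leq (arc_weight_ordSr vr)).
have pred2 r v : v != ord_pred r ->
    2 * arc_weight (ord_pred r) v <= arc_weight r v.
  by rewrite eq_sym => /arc_weight_ordSl->; rewrite ord_predK.
have ccw := reach_count C (@ord_pred_inj n) N0 arc_weightxx pred2.
have := leq_add cw ccw; rewrite -big_split /= => le.
suff : 4 * n <= 6 * config_size C by lia.
apply: leq_trans (leq_trans _ le) _; last by lia.
(* Every vertex counts at least 4 in the two sums together: 2 in each if occupied, otherwise 4 in a
   direction from which it is reached. *)
rewrite mulnC -[n in n * 4]card_ord -sum_nat_const; apply: leq_sum => r _.
by case: (C r) => [|c] //=; case: (reach r) => ->; rewrite //= ?andbT; lia.
Qed.

End Cycle.

(** * The upper bound, for supergraphs of the path *)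

Definition triples n : config 'I_n :=
  [ffun i : 'I_n => 2 * (i %% 3 == 1) + ((i.+1 == n) && (i %% 3 == 0))].

Lemma triples_size n : config_size (triples n) = (2 * n + 2) %/ 3.
Proof.
rewrite /config_size; under eq_bigr do rewrite ffunE.
rewrite big_split /= -big_distrr /=.
have -> : \sum_(i < n) (i %% 3 == 1) = (n + 1) %/ 3.
  by elim: n => [|m IHm]; rewrite ?big_ord0 // big_ord_recr /= IHm; lia.
have -> : \sum_(i < n) ((i.+1 == n) && (i %% 3 == 0)) = (n %% 3 == 1) :> nat.
  case: n => [|n]; first by rewrite big_ord0.
  rewrite big_ord_recr /= big1 ?eqxx /=; last first.
    by move=> i _; rewrite eqSS ltn_eqF.
  by congr nat_of_bool; lia.
lia.
Qed.

Lemma triples_win n (e : rel 'I_n) rule :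
  subrel (@path_rel n) e -> cops_win e rule (triples n).
Proof.
move=> path_e r.
have near (u : 'I_n) : u %% 3 = 1 -> path_rel u r ->
    cops_force e rule (triples n) r.
  move=> u1 ur; pose C' : config 'I_n :=
    [ffun w => triples n w - 2 * (w == u) + (w == r)].
  apply: (@Force_capture _ _ _ _ C').
    apply: pebbling_step_turn; apply/existsP; exists u; apply/existsP; exists r.
    by rewrite path_e // eqxx andbT ffunE u1.
  by rewrite /captured ffunE eqxx addn1.
have [r0|r1|r2] : [\/ r %% 3 = 0, r %% 3 = 1 | r %% 3 = 2].
  by case: (r %% 3) (ltn_pmod r (isT : 0 < 3)) => [|[|[|]]] //; constructor.
(* If [n] is 1 modulo 3, the last vertex has no successor with two cops; the single extra cop of
   [triples] stands there. *)
- have [rn|rn] := eqVneq r.+1 n.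
    by apply: Force_now; rewrite /captured ffunE rn r0 eqxx.
  have lt : r.+1 < n by rewrite ltn_neqAle rn ltn_ord.
  by apply: (near (Ordinal lt)); rewrite /path_rel /= ?eqxx ?orbT //; lia.
- by apply: Force_now; rewrite /captured ffunE r1.
- have lt : r.-1 < n by have := ltn_ord r; lia.
  by apply: (near (Ordinal lt)); rewrite /path_rel /=; lia.
Qed.

(** Paths and cycles both lie between [path_rel] and [cycle_rel], so one computation serves for
    both. *)
Lemma cop_pebbling_numberE n (e : rel 'I_n) rule :
    subrel (@path_rel n) e -> subrel e (@cycle_rel n) ->
  cop_pebbling_number e rule = (2 * n + 2) %/ 3.
Proof.
move=> path_e e_cycle; rewrite /cop_pebbling_number.
case: ex_minnP => m /asboolP[C sizeC win] min_m; apply/eqP; rewrite eqn_leq.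
rewrite min_m /=; last first.
  apply/asboolP; exists (triples n); first exact: triples_size.
  exact: triples_win.
by have := cops_win_size e_cycle win; rewrite sizeC; lia.
Qed.

Lemma path_rel_cycle n : subrel (@path_rel n) (@cycle_rel n).
Proof.
move=> i j; rewrite /path_rel /cycle_rel => /orP[] /eqP ij.
  by rewrite ij modn_small ?eqxx.
by rewrite ij (modn_small (ltn_ord i)) eqxx orbT.
Qed.

Lemma ceil_two_thirds (n : nat) :
  Num.ceil (2 * n%:R / 3 : rat)%R = Posz ((2 * n + 2) %/ 3).
Proof.
apply: ceil_def; set m := (2 * n + 2) %/ 3.
have [lo hi] : 2 * n <= 3 * m /\ 3 * m <= 2 * n + 2 by rewrite /m; lia.
move: lo hi; rewrite -!(ler_nat rat) natrD !natrM rmorphB /= => lo hi.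
by rewrite -!pmulrn; apply/andP; split; lra.
Qed.

Local Open Scope ring_scope.

Theorem theorem11 (rule : turn_rule) :
  (forall n : nat, (1 <= n)%N ->
     (cop_pebbling_number (@path_rel n) rule)%:Z
       = Num.ceil (2 * n%:R / 3 : rat))
  /\
  (forall n : nat, (3 <= n)%N ->
     (cop_pebbling_number (@cycle_rel n) rule)%:Z
       = Num.ceil (2 * n%:R / 3 : rat)).
Proof.
have sub := @path_rel_cycle.
by split=> n _; rewrite cop_pebbling_numberE // ceil_two_thirds.
Qed.
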